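(* Let $\mathcal{L}$ be a bounded lattice and let $\mathcal{P}$ and $\mathcal{Q}$ be filters of $\mathcal{L}$. If $\mathcal{P}\vee\mathcal{Q}$ is a $\mathcal{Q}$-filter of $\mathcal{L}$, then either $\mathcal{P}\subseteq\mathcal{Q}$, or $\mathcal{Q}$ is a prime filter of $\mathcal{L}$ and $\mathcal{Q}=\mathcal{Q}\vee\mathcal{P}$.
   Context: All lattices are bounded, with least element $0$ and greatest element $1$ (not assumed distributive). A filter of $\mathcal{L}$ is a non-empty subset $F$ such that $u\wedge v\in F$ for all $u,v\in F$, and $u\in F$, $w\in\mathcal{L}$, $u\le w$ imply $w\in F$; it is proper if $F\neq\mathcal{L}$. A proper filter $F$ is prime if $u\vee v\in F$ implies $u\in F$ or $v\in F$. For filters $\mathcal{I},\mathcal{J}$, $\mathcal{I}\vee\mathcal{J}=\{x\vee y\mid x\in\mathcal{I},\ y\in\mathcal{J}\}$. For proper filters $\mathcal{A},\mathcal{Q}$ of $\mathcal{L}$, $\mathcal{A}$ is a $\mathcal{Q}$-filter of $\mathcal{L}$ if for all $u,v\in\mathcal{L}$, $u\vee v\in\mathcal{A}$ and $u\notin\mathcal{Q}$ imply $v\in\mathcal{A}$ (so saying that $\mathcal{A}$ is a $\mathcal{Q}$-filter includes that $\mathcal{A}$ and $\mathcal{Q}$ are proper filters). *)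

(* Defs.v *)
From mathcomp Require Import all_boot all_order.
From mathcomp Require Import boolp classical_sets.

Set Implicit Arguments.
Unset Strict Implicit.
Unset Printing Implicit Defensive.

Local Open Scope classical_set_scope.

(* In classical_set_scope the infixes `&` and `|` are set operations, so the
   lattice operations are written Order.meet and Order.join. *)

Definition lattice_filter (d : Order.disp_t) (L : tbLatticeType d)
    (F : set L) : Prop :=
  [/\ F !=set0,
      (forall u v : L, F u -> F v -> F (Order.meet u v)) &
      (forall u w : L, F u -> (u <= w)%O -> F w)].

Definition proper_filter (d : Order.disp_t) (L : tbLatticeType d)
    (F : set L) : Prop :=
  lattice_filter F /\ F <> setT.

Definition prime_filter (d : Order.disp_t) (L : tbLatticeType d)
    (F : set L) : Prop :=
  proper_filter F /\ (forall u v : L, F (Order.join u v) -> F u \/ F v).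

Definition filter_join (d : Order.disp_t) (L : tbLatticeType d)
    (I J : set L) : set L :=
  [set Order.join x y | x in I & y in J].

(* [relative_filter Q A]: A is a Q-filter. *)
Definition relative_filter (d : Order.disp_t) (L : tbLatticeType d)
    (Q A : set L) : Prop :=
  [/\ proper_filter A,
      proper_filter Q &
      (forall u v : L, A (Order.join u v) -> ~ Q u -> A v)].

(* Main.v *)
Require Import Defs.
From mathcomp Require Import all_boot all_order.
From mathcomp Require Import boolp classical_sets.

(** Upward closure of [Q] always gives that [filter_join P Q] lies in [Q].  If
    some [p] in [P] is outside [Q], the relative filter condition cancels [p]
    from each [p] join [q], so the two sets coincide.  The condition with [Q] in
    place of [filter_join P Q] is then exactly primeness of [Q]. *)

Import Order.LTheory.
Local Open Scope classical_set_scope.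

Lemma filter_joinC (d : Order.disp_t) (L : tbLatticeType d) (I J : set L) :
  filter_join I J = filter_join J I.
Proof.
by apply/seteqP; split=> _ [x Ix [y Jy <-]]; exists y => //; exists x => //;
  exact: joinC.
Qed.

Lemma filter_join_subr (d : Order.disp_t) (L : tbLatticeType d) (I J : set L) :
  lattice_filter J -> filter_join I J `<=` J.
Proof.
by move=> [_ _ upJ] _ [x _ [y Jy <-]]; apply: upJ Jy (leUr _ _).
Qed.

Theorem theorem3p8 (d : Order.disp_t) (L : tbLatticeType d) (P Q : set L)
    (filterP : lattice_filter P) (filterQ : lattice_filter Q)
    (PQ : relative_filter Q (filter_join P Q)) :
  P `<=` Q \/ (prime_filter Q /\ Q = filter_join Q P).
Proof.
have [sPQ|/existsNP[p /not_implyP[Pp nQp]]] := pselect (P `<=` Q); first by left.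
case: PQ => _ properQ relPQ; right.
have defQ : filter_join P Q = Q.
  apply/seteqP; split=> [|q Qq]; first exact: filter_join_subr.
  by apply: (relPQ p) => //; exists p => //; exists q.
split; last by rewrite filter_joinC defQ.
split=> // u v Quv; have [Qu|nQu] := pselect (Q u); [by left | right].
by rewrite -defQ; apply: relPQ nQu; rewrite defQ.
Qed.
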